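(* Let $k$ be a positive integer, let $\mathcal{C}=(c_1,\dots,c_k)$ be a $k$-tuple of positive integers with $c_i\le c_{i+1}$, and put $\mathbf{h}=c_1+\cdots+c_k$. For every positive integer $n$, $$\delta_k(\mathcal{C};n)=q_k(\mathcal{C};8n+\mathbf{h}).$$ That is, the number of representations of $n$ by $\sum_{i=1}^k c_i\frac{z_i(z_i+1)}{2}$ equals the number of representations of $8n+\mathbf{h}$ as a sum of $k$ odd integer squares with coefficients $c_i$. In particular, when all $c_i=1$, $\delta_k(n)=q_k(8n+k)$.
   Context: $\delta_k(\mathcal{C};n)=\#\{(z_1,\dots,z_k)\in\mathbb{Z}_{\ge 0}^k: n=\sum_{i=1}^k c_i\frac{z_i(z_i+1)}{2}\}$ and $q_k(\mathcal{C};n)=\#\{(y_1,\dots,y_k)\in\mathbb{Z}^k: n=\sum_{i=1}^k c_iy_i^2,\ y_i\ge 0,\ 2\nmid y_i\}$. When all $c_i=1$ these are written $\delta_k(n)$ and $q_k(n)$. *)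

(* Defs.v *)
From mathcomp Require Import all_boot all_order all_algebra.
From mathcomp Require Import finmap.
From mathcomp Require Import boolp classical_sets functions cardinality.

Set Implicit Arguments.
Unset Strict Implicit.
Unset Printing Implicit Defensive.

Import Order.TTheory GRing.Theory Num.Theory.

Local Open Scope classical_set_scope.

(* The division is exact, since z (z + 1) is even. *)
Definition triangular (z : nat) : nat := (z * (z + 1)) %/ 2.

Definition triangular_reps (k : nat) (c : k.-tuple nat) (n : nat) :
    set (k.-tuple nat) :=
  [set z : k.-tuple nat | n = \sum_(i < k) tnth c i * triangular (tnth z i)].

Definition odd_square_reps (k : nat) (c : k.-tuple nat) (n : nat) :
    set (k.-tuple int) :=
  [set y : k.-tuple int |
     [/\ (n%:Z = \sum_(i < k) (tnth c i)%:Z * tnth y i ^+ 2)%R,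
         forall i : 'I_k, (0 <= tnth y i)%R
       & forall i : 'I_k, ~~ (2 %| tnth y i)%Z]].

(* [fset_set A] is a junk value (the empty set) when [A] is infinite; for
   positive coefficients both sets of representations are finite, see
   [finite_triangular_reps] and [finite_odd_square_reps] below. *)
Definition delta (k : nat) (c : k.-tuple nat) (n : nat) : nat :=
  #|` fset_set (triangular_reps c n)|.

Definition q (k : nat) (c : k.-tuple nat) (n : nat) : nat :=
  #|` fset_set (odd_square_reps c n)|.

Definition ones (k : nat) : k.-tuple nat := [tuple 1 | _ < k].

Lemma leq_triangular (z : nat) : z <= triangular z.
Proof.
rewrite /triangular leq_divRL // leq_mul2l addn1 ltnS.
by case: z.
Qed.

Lemma finite_bounded_tuples (k m : nat) :
  finite_set [set z : k.-tuple nat | forall i, tnth z i <= m].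
Proof.
apply: (sub_finite_set (B := (map_tuple (@nat_of_ord m.+1)) @`
  [set: k.-tuple 'I_m.+1])); last exact/finite_image/finite_finset.
move=> z zm; exists (map_tuple inord z) => //.
by apply: eq_from_tnth => i; rewrite !tnth_map inordK // ltnS zm.
Qed.

Lemma finite_triangular_reps (k : nat) (c : k.-tuple nat) (n : nat) :
  (forall i : 'I_k, 0 < tnth c i) -> finite_set (triangular_reps c n).
Proof.
move=> c0; apply: sub_finite_set (finite_bounded_tuples k n) => z /= -> i.
rewrite (bigD1 i) //=; apply: leq_trans (leq_addr _ _).
by apply: leq_trans (leq_triangular _) _; rewrite leq_pmull.
Qed.

Lemma finite_odd_square_reps (k : nat) (c : k.-tuple nat) (n : nat) :
  (forall i : 'I_k, 0 < tnth c i) -> finite_set (odd_square_reps c n).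
Proof.
move=> c0; apply: (sub_finite_set (B := (map_tuple Posz) @`
  [set z : k.-tuple nat | forall i, tnth z i <= n])); last first.
  exact/finite_image/finite_bounded_tuples.
move=> y [ny y0 _]; exists (map_tuple absz y) => [i /=|]; last first.
  by apply: eq_from_tnth => i; rewrite !tnth_map gez0_abs.
rewrite tnth_map -lez_nat gez0_abs // ny (bigD1 i) //=.
have sq0 j : (0 <= (tnth c j)%:Z * tnth y j ^+ 2)%R.
  by rewrite mulr_ge0 // exprn_ge0.
apply: ler_wpDr; first by apply: sumr_ge0.
rewrite -[in X in (_ <= X)%R](gez0_abs (y0 i)).
rewrite expr2 -!PoszM -[X in (X <= _)%R](gez0_abs (y0 i)) lez_nat mulnA.
case: (`|tnth y i|%N) => [|a] //.
by rewrite leq_pmull // muln_gt0 c0.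
Qed.

(* Main.v *)
(* Completing the square, [8 z(z+1)/2 + 1 = (2z+1)^2], so [z |-> 2z+1] applied
   coordinatewise is a bijection between the two sets of representations. *)
Require Import Defs.
From mathcomp Require Import all_boot all_order all_algebra.
From mathcomp Require Import finmap.
From mathcomp Require Import classical_sets cardinality.

Import GRing.Theory.

(** Weighting the identity [8 * triangular z + 1 = (2 * z + 1) ^ 2] by [c_i] and summing shows that
    [z] represents [n] by triangular numbers exactly when the tuple of the [2 * z_i + 1] represents
    [8 * n + h] by squares, with [h] the sum of the [c_i]. Every nonnegative odd integer is
    [2 * z + 1] for a unique natural [z], so one solution set is the injective image of the other
    ([odd_square_repsE]), and the counts agree. *)

Lemma triangular_square (z : nat) : 8 * triangular z + 1 = (2 * z + 1) ^ 2.
Proof.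
(* Evenness makes the floor division in [triangular] exact, so a factor 2 taken out of 8 cancels
   it. *)
have even_z : 2 %| z * (z + 1) by rewrite dvdn2 oddM addn1 /= andbN.
rewrite /triangular -[8]/(4 * 2) -mulnA [2 * _]mulnC divnK //.
by rewrite sqrnD expnMn !muln1 mulnDr muln1 mulnn mulnDr mulnA addnAC.
Qed.

Lemma weighted_triangular_sum (k : nat) (c z : k.-tuple nat) :
  8 * \sum_(i < k) tnth c i * triangular (tnth z i) + \sum_(i < k) tnth c i
  = \sum_(i < k) tnth c i * (2 * tnth z i + 1) ^ 2.
Proof.
rewrite big_distrr /= -big_split; apply: eq_bigr => i _ /=.
by rewrite -triangular_square mulnDr muln1 mulnCA.
Qed.

Definition odd_int (z : nat) : int := Posz (2 * z + 1).

Lemma odd_int_inj : injective odd_int.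
Proof. by move=> a b [] /addIn /eqP; rewrite eqn_pmul2l // => /eqP. Qed.

(** Supplies surjectivity: rounding down in [./2] drops exactly the final 1 of an odd number. *)
Lemma odd_intK (y : int) :
  (0 <= y)%R -> ~~ (2 %| y)%Z -> odd_int `|y|%N./2 = y.
Proof.
case: y => // m _; rewrite dvdzE /= dvdn2 negbK => odd_m.
by rewrite /odd_int -[in RHS](odd_double_half m) odd_m mul2n addnC.
Qed.

Lemma weighted_odd_square_sum (k : nat) (c z : k.-tuple nat) :
  (\sum_(i < k) (tnth c i)%:Z * tnth (map_tuple odd_int z) i ^+ 2)%R
  = Posz (8 * \sum_(i < k) tnth c i * triangular (tnth z i)
          + \sum_(i < k) tnth c i).
Proof.
rewrite weighted_triangular_sum -natz natr_sum; apply: eq_bigr => i _.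
by rewrite tnth_map natz.
Qed.

Lemma odd_square_repsE (k : nat) (c : k.-tuple nat) (n : nat) :
  odd_square_reps c (8 * n + \sum_(i < k) tnth c i)
  = (map_tuple odd_int @` triangular_reps c n)%classic.
Proof.
apply/seteqP; split=> [y [ny y0 y_odd]|_ [z /= -> <-]]; last first.
  split=> [|i|i]; rewrite ?weighted_odd_square_sum // tnth_map //.
  by rewrite dvdzE /= dvdn2 addn1 mul2n /= odd_double.
have yE : map_tuple odd_int (map_tuple (fun t : int => `|t|%N./2) y) = y.
  by apply: eq_from_tnth => i; rewrite !tnth_map odd_intK.
exists (map_tuple (fun t : int => `|t|%N./2) y) => //.
(* With [y] written as an image, its sum of squares has the form [8 * _ + h]; cancelling [h] and
   then 8 leaves the triangular equation for [n]. *)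
move: ny; rewrite -[in X in X -> _]yE weighted_odd_square_sum => -[] /addIn /eqP.
by rewrite eqn_pmul2l // => /eqP.
Qed.

Lemma delta_eq_q (k : nat) (c : k.-tuple nat) (n : nat) :
  (forall i : 'I_k, 0 < tnth c i) ->
  delta c n = q c (8 * n + \sum_(i < k) tnth c i).
Proof.
(* Positivity of the coefficients gives finiteness, without which [fset_set] would not commute with
   the image. *)
move=> c0; rewrite /q odd_square_repsE fset_set_image; last first.
  exact: finite_triangular_reps.
rewrite card_imfset //= => z z' /(congr1 val) /=.
by move/(inj_map odd_int_inj)/val_inj.
Qed.

Theorem proposition1p6 (k : nat) (hk : 0 < k) :
  (forall c : k.-tuple nat,
     (forall i : 'I_k, 0 < tnth c i) -> sorted leq c ->
     forall n : nat, 0 < n ->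
       delta c n = q c (8 * n + \sum_(i < k) tnth c i)) /\
  (forall n : nat, 0 < n -> delta (ones k) n = q (ones k) (8 * n + k)).
Proof.
split=> [c c0 _ n _|n _]; first exact: delta_eq_q.
have ones1 i : tnth (ones k) i = 1 by rewrite tnth_mktuple.
rewrite delta_eq_q => [|i]; last by rewrite ones1.
by under eq_bigr do rewrite ones1; rewrite sum1_card card_ord.
Qed.
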